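(* Let $A$ be an $n\times n$ complex matrix. Then every eigenvector of $A$ is an eigenvector of $A^*$ (possibly associated with a different eigenvalue) if and only if $A$ is normal, that is, $A^*A=AA^*$.
   Context: $A^*$ denotes the conjugate transpose of $A$. An eigenvector of an $n\times n$ matrix $M$ is a nonzero vector $v\in\mathbb{C}^n$ such that $Mv=\lambda v$ for some $\lambda\in\mathbb{C}$. *)

(* Defs.v *)
From mathcomp Require Export all_boot all_order all_algebra.
From mathcomp Require Export sesquilinear spectral reals complex.
Set Implicit Arguments. Unset Strict Implicit. Unset Printing Implicit Defensive.
Import GRing.Theory Num.Theory.
Local Open Scope ring_scope.

(* [eigenvalue] and [eigenspace] of mxalgebra act on row vectors (v *m M); here
   eigenvectors are column vectors and M acts on the left. *)
Definition eigenvector (C : numClosedFieldType) (n : nat) (M : 'M[C]_n) (v : 'cV[C]_n)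
  : Prop := v != 0 /\ exists lambda : C, M *m v = lambda *: v.

(* Main.v *)
(* By Schur, A = P^* T P with P unitary and T lower triangular, and the
   hypothesis on A passes to T. Going down from the last basis vector, each e_j
   is an eigenvector of T: if e_k is one for every k > j then it is one of T^*
   too, so row k of T is diagonal, whence column j of T vanishes below the
   diagonal. Thus T is diagonal and A is normal. *)
Require Import Defs.
Import GRing.Theory Num.Theory.
Local Open Scope ring_scope.
Local Open Scope sesquilinear_scope.

Lemma eigenvector_unitary_conj (C : numClosedFieldType) n (P M : 'M[C]_n) v :
  P \is unitarymx ->
  eigenvector (P^t* *m M *m P) v <-> eigenvector M (P *m v).
Proof.
move=> Pu; have PV : P *m P^t* = 1%:M by apply/unitarymxP.
have VP : P^t* *m P = 1%:M by exact: mulmx1C.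
have v0 : (P *m v == 0) = (v == 0).
  apply/eqP/eqP => [Pv0|->]; last exact: mulmx0.
  by rewrite -[v]mul1mx -VP -mulmxA Pv0 mulmx0.
rewrite /eigenvector v0; split=> -[vN0 [l Ml]]; split=> //; exists l.
  by rewrite scalemxAr -Ml !mulmxA PV mul1mx.
by rewrite -!mulmxA Ml -scalemxAr mulmxA VP mul1mx.
Qed.

Lemma adjoint_unitary_conj (C : numClosedFieldType) n (P M : 'M[C]_n) :
  (P^t* *m M *m P)^t* = P^t* *m M^t* *m P.
Proof. by rewrite !trmx_mul !map_mxM trmxCK mulmxA. Qed.

(** [M *m delta_mx k 0] is column [k] of [M], and the eigenvalue is then [M k k]. *)
Lemma eigenvector_delta (C : numClosedFieldType) n (M : 'M[C]_n) (k : 'I_n) :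
  eigenvector M (delta_mx k 0) <-> (forall i, i != k -> M i k = 0).
Proof.
split=> [[_ [l Ml]] i ik|Mk0].
  have := congr1 (fun u : 'cV_n => u i 0) Ml.
  by rewrite -colE !mxE (negbTE ik) mulr0.
split.
  apply/eqP => /matrixP /(_ k 0) /eqP.
  by rewrite !mxE !eqxx oner_eq0.
exists (M k k); apply/colP => i; rewrite -colE !mxE andbT.
by case: eqVneq => [->|/Mk0 ->]; rewrite ?mulr1 ?mulr0.
Qed.

Lemma trig_eigenvector_diag (C : numClosedFieldType) n (T : 'M[C]_n) :
  is_trig_mx T ->
  (forall v : 'cV[C]_n, eigenvector T v -> eigenvector (T ^t*) v) ->
  is_diag_mx T.
Proof.
move=> /is_trig_mxP Ttrig TTs.
(* Bounding [n - j] by [m] makes the induction descend from the last index; [m = 0] is vacuous since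
   [j < n]. *)
suff Tcol m (j : 'I_n) : (n - j <= m)%N -> eigenvector T (delta_mx j 0).
  apply/is_diag_mxP => i j ij.
  by have /eigenvector_delta -> := Tcol _ j (leqnn _).
elim: m j => [|m IHm] j; first by rewrite leqn0 subn_eq0 leqNgt ltn_ord.
move=> njm; apply/eigenvector_delta => i ij.
have [lt_ij|lt_ji|/val_inj eq_ij] := ltngtP i j; first exact: Ttrig.
  (* Column [i] of [T ^t*] is the conjugate of row [i] of [T], so its entry [j] controls [T i j]. *)
  have /TTs/eigenvector_delta/(_ j) : eigenvector T (delta_mx i 0).
    by apply: IHm; rewrite -ltnS (leq_trans _ njm)// ltn_sub2l.
  by rewrite eq_sym !mxE => /(_ ij) /eqP; rewrite conjC_eq0 => /eqP.
by rewrite eq_ij eqxx in ij.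
Qed.

Lemma normal_eigenvector_adjoint (C : numClosedFieldType) n (A : 'M[C]_n) v :
  A \is normalmx -> eigenvector A v -> eigenvector (A ^t*) v.
Proof.
have Pu := spectral_unitarymx A.
move=> /orthomx_spectralP; rewrite invmx_unitary // => ->.
rewrite adjoint_unitary_conj !eigenvector_unitary_conj //.
set d := spectral_diag A; move: (_ *m v) => w [wN0 [l Dw]].
(* In the spectral basis, [d 0 i = l] wherever [w i 0] is nonzero, so conjugating [d] turns [l] into
   [l^*] there; elsewhere both sides vanish. *)
split=> //; exists l^*; apply/colP => i.
have /colP/(_ i) := Dw.
rewrite tr_diag_mx map_diag_mx !mul_diag_mx !mxE.
have [->|wi0] := eqVneq (w i 0) 0; first by rewrite !mulr0.
by move=> /(mulIf wi0) ->.
Qed.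

Lemma eigenvector_adjoint_normal (C : numClosedFieldType) n (A : 'M[C]_n) :
  (forall v : 'cV[C]_n, eigenvector A v -> eigenvector (A ^t*) v) ->
  A \is normalmx.
Proof.
(* [Schur] requires positive size. *)
case: n A => [|n] A AAs; first by apply/normalmxP; rewrite !thinmx0.
have [P Pu] := Schur A (ltn0Sn n); rewrite /= => PAtrig.
have PV : P *m P^t* = 1%:M by apply/unitarymxP.
have VP : P^t* *m P = 1%:M by exact: mulmx1C.
pose T := P *m A *m P^t*.
have AE : A = P^t* *m T *m P by rewrite /T !mulmxA VP mul1mx -mulmxA VP mulmx1.
have /diag_mxP[d Td] : is_diag_mx T.
  apply: trig_eigenvector_diag => [|w Tw]; first by rewrite /T -conjymx.
  (* The hypothesis on [A] is applied to [P^t* *m w], the vector [w] in the original basis. *)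
  have wE : w = P *m (P^t* *m w) by rewrite mulmxA PV mul1mx.
  rewrite wE -eigenvector_unitary_conj // -adjoint_unitary_conj -AE.
  by apply: AAs; rewrite AE eigenvector_unitary_conj // -wE.
(* A unitarily diagonalizable matrix is normal. *)
apply/orthomx_spectral_subproof; exists (P, d) => //=.
by rewrite invmx_unitary // -Td.
Qed.

Theorem theorem1 (R : realType) (n : nat) (A : 'M[R[i]]_n) :
  (forall v : 'cV[R[i]]_n, eigenvector A v -> eigenvector (A ^t*) v)
  <-> A \is normalmx.
Proof.
split; first exact: eigenvector_adjoint_normal.
by move=> Anormal v; exact: normal_eigenvector_adjoint.
Qed.
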